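(* Let $c \geq 1$ be a real number and let $G$ be a (possibly infinite) graph whose growth satisfies $f_G(r) \leq cr$ for every positive integer $r$. Then $\operatorname{tw}(G) \leq 49c^2 + 30c$.
   Context: Graphs are undirected and may be infinite. The growth of a graph $G$ is the function $f_G\colon \mathbb{N}\to\mathbb{N}\cup\{\infty\}$ (with $\mathbb{N}$ the positive integers) where $f_G(r)$ is the supremum of $|V(H)|$ over all subgraphs $H$ of $G$ of radius at most $r$. A tree-decomposition of $G$ is a family $(B_x \subseteq V(G) : x\in V(T))$ indexed by the nodes of a tree $T$ such that every edge of $G$ has both ends in some bag $B_x$, and for every vertex $v$ the set $\{x : v\in B_x\}$ induces a non-empty subtree of $T$. Its width is the maximum bag size minus $1$. The treewidth $\operatorname{tw}(G)$ is the minimum width of a tree-decomposition of $G$, or $\infty$ if no tree-decomposition of finite width exists. *)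

(* Defs.v *)
From Stdlib Require Import Reals List.
Import ListNotations.
Open Scope R_scope.

Section Defs.
Context {V : Type}.

Inductive walk (E : V -> V -> Prop) : V -> V -> nat -> Prop :=
| walk0 x : walk E x x 0
| walkS x y z n : E x y -> walk E y z n -> walk E x z (S n).

Definition card_le (P : V -> Prop) (k : R) : Prop :=
  forall l : list V, NoDup l -> Forall P l -> INR (length l) <= k.

Definition is_subgraph (adj : V -> V -> Prop) (S : V -> Prop) (E : V -> V -> Prop) : Prop :=
  (forall x y, E x y -> adj x y) /\
  (forall x y, E x y -> S x /\ S y) /\
  (forall x y, E x y -> E y x).

Definition radius_le (S : V -> Prop) (E : V -> V -> Prop) (r : nat) : Prop :=
  exists v, S v /\ forall u, S u -> exists n, (n <= r)%nat /\ walk E v u n.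

Definition growth_le (adj : V -> V -> Prop) (r : nat) (k : R) : Prop :=
  forall (S : V -> Prop) (E : V -> V -> Prop),
    is_subgraph adj S E -> radius_le S E r -> card_le S k.

Fixpoint chain (E : V -> V -> Prop) (x : V) (l : list V) : Prop :=
  match l with
  | [] => True
  | y :: l' => E x y /\ chain E y l'
  end.

Definition has_cycle (E : V -> V -> Prop) : Prop :=
  exists x l, NoDup (x :: l) /\ (2 <= length l)%nat /\ chain E x l /\ E (last l x) x.

Definition connected (E : V -> V -> Prop) : Prop :=
  forall x y, exists n, walk E x y n.

Definition is_tree (E : V -> V -> Prop) : Prop :=
  (exists x : V, True) /\
  (forall x y, E x y -> E y x) /\ (forall x, ~ E x x) /\
  connected E /\ ~ has_cycle E.
End Defs.

Definition tree_decomposition {V X : Type} (adj : V -> V -> Prop)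
  (T : X -> X -> Prop) (B : X -> V -> Prop) : Prop :=
  is_tree T /\
  (forall u v, adj u v -> exists x, B x u /\ B x v) /\
  (forall v, (exists x, B x v) /\
     forall x y, B x v -> B y v ->
       exists n, walk (fun a b => T a b /\ B a v /\ B b v) x y n).

(* tw(G) <= k : some tree-decomposition has width <= k, i.e. all bags have size <= k+1 *)
Definition treewidth_le {V : Type} (adj : V -> V -> Prop) (k : R) : Prop :=
  exists (X : Type) (T : X -> X -> Prop) (B : X -> V -> Prop),
    tree_decomposition adj T B /\ forall x, card_le (B x) (k + 1).

(* Main.v *)
(* Only the ball bound |B(v,r)| <= cr is used. It gives, for every finite set A, a set X of
   at most 10c^2 vertices such that no component of G - X contains more than half of A: let r
   be the least radius of a ball B(v,r) containing a majority of A, and cover B(v,r) by about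
   5c balls of radius r/2, each of which can be cut off by a sphere of at most 2c vertices and
   radius in [r/2, r]. The tree-decomposition is then built from the root downwards: a
   component C with neighbourhood N(C) gets the bag N(C) + (X inter C) + w, with X a balanced
   separator for A = N(C), and the construction recurses into the components of what remains
   of C. Taking for w a vertex of C closest to a base point of its component of G ensures that
   every vertex is reached after finitely many steps, although G may be infinite. *)
Require Import Defs.
From Stdlib Require Import Reals List Lra Lia Arith Classical ClassicalEpsilon.
From Stdlib Require Import FunctionalExtensionality PropExtensionality.
Import ListNotations.
Open Scope R_scope.

(** * Extremal numbers, cardinality bounds and majorities *)

Lemma nat_least (Q : nat -> Prop) (n : nat) :
  Q n -> exists m, Q m /\ forall k, (k < m)%nat -> ~ Q k.
Proof.
  induction n as [n IH] using lt_wf_ind; intros Hn.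
  destruct (classic (exists k, (k < n)%nat /\ Q k)) as [[k [Hk HQ]] | H].
  - exact (IH k Hk HQ).
  - exists n; split; [exact Hn |]; intros k Hk HQ; apply H; eauto.
Qed.

Lemma nat_greatest (Q : nat -> Prop) (n : nat) (b : R) :
  Q n -> (forall m, Q m -> INR m <= b) ->
  exists m, Q m /\ forall k, Q k -> (k <= m)%nat.
Proof.
  intros Hn Hb; destruct (INR_unbounded b) as [N HN].
  assert (HbN : forall m, Q m -> (m <= N)%nat)
    by (intros m Hm; apply INR_le; specialize (Hb m Hm); lra).
  clear b Hb HN.
  destruct (nat_least (fun j => Q (N - j)%nat) (N - n)) as [j [Hj Hmin]].
  - replace (N - (N - n))%nat with n by (specialize (HbN n Hn); lia); exact Hn.
  - exists (N - j)%nat; split; [exact Hj |]; intros k Hk.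
    destruct (le_lt_dec k (N - j)) as [| Hlt]; [assumption | exfalso].
    specialize (HbN k Hk); apply (Hmin (N - k)%nat); [lia |].
    replace (N - (N - k))%nat with k by lia; exact Hk.
Qed.

Section Cardinality.
Context {V : Type}.

Lemma card_le_mono (P Q : V -> Prop) (a b : R) :
  (forall x, Q x -> P x) -> a <= b -> card_le P a -> card_le Q b.
Proof.
  intros HQ Hab HP l Hnd Hl; apply Rle_trans with a; [| exact Hab].
  apply HP; [exact Hnd |]; eapply Forall_impl; eauto.
Qed.

Lemma card_le_In (l : list V) : card_le (fun x => In x l) (INR (length l)).
Proof.
  intros l' Hnd Hl; apply le_INR, NoDup_incl_length; [exact Hnd |].
  rewrite Forall_forall in Hl; exact Hl.
Qed.

Lemma card_le_union (P Q : V -> Prop) (a b : R) :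
  card_le P a -> card_le Q b -> card_le (fun x => P x \/ Q x) (a + b).
Proof.
  intros HP HQ l Hnd Hl.
  set (f := fun x => if excluded_middle_informative (P x) then true else false).
  rewrite <- (filter_length f l), plus_INR; apply Rplus_le_compat.
  - apply HP; [apply NoDup_filter, Hnd |].
    apply Forall_forall; intros x [_ Hx]%filter_In; unfold f in Hx.
    destruct (excluded_middle_informative (P x)); [assumption | discriminate].
  - apply HQ; [apply NoDup_filter, Hnd |].
    rewrite Forall_forall in Hl.
    apply Forall_forall; intros x [Hx Hf]%filter_In; unfold f in Hf.
    destruct (excluded_middle_informative (P x)); [discriminate |].
    destruct (Hl x Hx); tauto.
Qed.

(** Since [b] bounds their lengths, some duplicate-free list in [P] is longest, and it can omit no
    element of [P]. *)
Lemma card_le_enum (P : V -> Prop) (b : R) :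
  card_le P b -> exists l, NoDup l /\ forall x, In x l <-> P x.
Proof.
  intros HP.
  destruct (nat_greatest
    (fun n => exists l, NoDup l /\ Forall P l /\ length l = n) 0 b)
    as [m [[l [Hnd [Hl Hm]]] Hmax]].
  - exists []; repeat constructor.
  - intros m [l [Hnd [Hl <-]]]; auto.
  - exists l; split; [exact Hnd |]; intros x; split.
    + rewrite Forall_forall in Hl; apply Hl.
    + intros Hx; apply NNPP; intros Hn.
      assert (S m <= m)%nat; [| lia].
      apply Hmax; exists (x :: l); repeat split; try constructor; auto.
      simpl; congruence.
Qed.

Definition majority (S : list V) (P : V -> Prop) : Prop :=
  exists l, NoDup l /\ incl l S /\ Forall P l /\ (length S < 2 * length l)%nat.

Lemma majority_mono (S : list V) (P Q : V -> Prop) :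
  (forall x, P x -> Q x) -> majority S P -> majority S Q.
Proof.
  intros H [l (Hnd & Hi & Hl & Hlen)]; exists l; repeat split; auto.
  eapply Forall_impl; eauto.
Qed.

Lemma majority_meet (S : list V) (P Q : V -> Prop) :
  majority S P -> majority S Q -> exists x, P x /\ Q x.
Proof.
  intros [l (Hnd & Hi & Hl & Hlen)] [l' (Hnd' & Hi' & Hl' & Hlen')].
  apply NNPP; intros Hn.
  assert (length (l ++ l') <= length S)%nat.
  { apply NoDup_incl_length; [apply NoDup_app; auto | apply incl_app; auto].
    rewrite Forall_forall in Hl, Hl'; intros x Hx Hx'; apply Hn; eauto. }
  rewrite length_app in H; lia.
Qed.

Lemma majority_witness (S : list V) (P Q : V -> Prop) :
  majority S P -> ~ majority S Q -> exists x, P x /\ ~ Q x.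
Proof.
  intros HP HQ; apply NNPP; intros Hn; apply HQ.
  apply majority_mono with P; [| exact HP].
  intros x Hx; apply NNPP; eauto.
Qed.
End Cardinality.

(** * Walks, components, balls and spheres *)

Section Walks.
Context {V : Type}.

Definition reach (E : V -> V -> Prop) (x y : V) : Prop := exists n, walk E x y n.

Lemma walk_app (E : V -> V -> Prop) x y z n m :
  walk E x y n -> walk E y z m -> walk E x z (n + m).
Proof. induction 1; simpl; [auto | intros; econstructor; eauto]. Qed.

Lemma walk_step (E : V -> V -> Prop) x y : E x y -> walk E x y 1.
Proof. intros; econstructor; [eassumption | constructor]. Qed.

Lemma walk_mono (E E' : V -> V -> Prop) x y n :
  (forall a b, E a b -> E' a b) -> walk E x y n -> walk E' x y n.
Proof. intros H; induction 1; econstructor; eauto. Qed.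

Lemma walk_sym (E : V -> V -> Prop) x y n :
  (forall a b, E a b -> E b a) -> walk E x y n -> walk E y x n.
Proof.
  intros H; induction 1; [constructor |].
  rewrite <- Nat.add_1_r; eapply walk_app; [eassumption | apply walk_step; auto].
Qed.

Lemma walk_split (E : V -> V -> Prop) x y k m :
  walk E x y (k + m) -> exists z, walk E x z k /\ walk E z y m.
Proof.
  revert x; induction k as [| k IH]; simpl; intros x H.
  - exists x; split; [constructor | exact H].
  - inversion H; subst.
    match goal with W : walk E _ y (k + m) |- _ => apply IH in W as [z [? ?]] end.
    exists z; split; [econstructor; eauto | exact H2].
Qed.

Lemma reach_refl (E : V -> V -> Prop) x : reach E x x.
Proof. exists 0%nat; constructor. Qed.

Lemma reach_trans (E : V -> V -> Prop) x y z : reach E x y -> reach E y z -> reach E x z.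
Proof. intros [n Hn] [m Hm]; exists (n + m)%nat; eapply walk_app; eauto. Qed.

Lemma reach_step (E : V -> V -> Prop) x y : E x y -> reach E x y.
Proof. intros H; exists 1%nat; apply walk_step, H. Qed.

Lemma reach_sym (E : V -> V -> Prop) x y :
  (forall a b, E a b -> E b a) -> reach E x y -> reach E y x.
Proof. intros H [n Hn]; exists n; apply walk_sym; auto. Qed.

Lemma reach_mono (E E' : V -> V -> Prop) x y :
  (forall a b, E a b -> E' a b) -> reach E x y -> reach E' x y.
Proof. intros H [n Hn]; exists n; eapply walk_mono; eauto. Qed.

Lemma reach_exit (E : V -> V -> Prop) (P : V -> Prop) x y :
  reach E x y -> P x -> ~ P y -> exists a b, E a b /\ P a /\ ~ P b.
Proof.
  intros [n W]; induction W as [x | x y z n Hxy W IH]; intros Hx Hy; [tauto |].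
  destruct (classic (P y)); eauto.
Qed.

Definition inside (adj : V -> V -> Prop) (P : V -> Prop) (a b : V) : Prop :=
  adj a b /\ P a /\ P b.

(** The conjunct [P x] makes the component empty when [x] lies outside [P], in spite of the walk of
    length zero. *)
Definition comp (adj : V -> V -> Prop) (P : V -> Prop) (x y : V) : Prop :=
  P x /\ reach (inside adj P) x y.

Definition nbhd (adj : V -> V -> Prop) (C : V -> Prop) (u : V) : Prop :=
  ~ C u /\ exists x, C x /\ adj x u.

Definition ball (adj : V -> V -> Prop) (v : V) (r : nat) (u : V) : Prop :=
  exists n, (n <= r)%nat /\ walk adj v u n.

Lemma comp_refl adj (P : V -> Prop) x : P x -> comp adj P x x.
Proof. intros H; split; [exact H | apply reach_refl]. Qed.

Lemma comp_sub adj (P : V -> Prop) x y : comp adj P x y -> P y.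
Proof. intros [Hx [n W]]; induction W as [| x y z n [_ [_ Hy]] _ IH]; auto. Qed.

Lemma comp_step adj (P : V -> Prop) x y z :
  comp adj P x y -> adj y z -> P z -> comp adj P x z.
Proof.
  intros H Hyz Hz; pose proof (comp_sub _ _ _ _ H) as Hy; destruct H as [Hx H].
  split; [exact Hx |]; eapply reach_trans; [exact H |]; apply reach_step; repeat split; auto.
Qed.

Lemma comp_mono adj (P Q : V -> Prop) x y :
  (forall z, P z -> Q z) -> comp adj P x y -> comp adj Q x y.
Proof.
  intros H [Hx W]; split; [auto |]; eapply reach_mono; [| exact W].
  intros a b (? & ? & ?); repeat split; auto.
Qed.

(** Equality, not mere equivalence, matters because components later label the nodes of the tree. *)
Lemma comp_eq adj (P : V -> Prop) x y :
  (forall a b, adj a b -> adj b a) -> comp adj P x y -> comp adj P x = comp adj P y.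
Proof.
  intros Hs H; pose proof (comp_sub _ _ _ _ H) as Hy; destruct H as [Hx H].
  assert (Hi : forall a b, inside adj P a b -> inside adj P b a)
    by (intros a b (? & ? & ?); repeat split; auto).
  apply functional_extensionality; intros z; apply propositional_extensionality.
  split; intros [_ W]; split; auto; eapply reach_trans; eauto using reach_sym.
Qed.

Lemma ball_center adj (v : V) r : ball adj v r v.
Proof. exists 0%nat; split; [lia | constructor]. Qed.

Lemma ball_mono adj (v u : V) r s : (r <= s)%nat -> ball adj v r u -> ball adj v s u.
Proof. intros H [n [Hn W]]; exists n; split; [lia | exact W]. Qed.

Lemma ball_trans adj (v u w : V) r s :
  ball adj v r u -> ball adj u s w -> ball adj v (r + s) w.
Proof.
  intros [n [Hn W]] [m [Hm W']]; exists (n + m)%nat; split; [lia |].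
  eapply walk_app; eauto.
Qed.

Lemma ball_sym adj (v u : V) r :
  (forall a b, adj a b -> adj b a) -> ball adj v r u -> ball adj u r v.
Proof. intros Hs [n [Hn W]]; exists n; split; [exact Hn | apply walk_sym; auto]. Qed.

Lemma ball_0 adj (v u : V) : ball adj v 0 u -> u = v.
Proof. intros [n [Hn W]]; inversion W; subst; [reflexivity | lia]. Qed.

Definition sphere (adj : V -> V -> Prop) (v : V) (t : nat) (u : V) : Prop :=
  ball adj v t u /\ forall s, (s < t)%nat -> ~ ball adj v s u.

(** On a shortest walk from [v] to [u], the vertex after [t] steps works: a shorter way to it would
    shorten the whole walk. *)
Lemma sphere_inhabited adj (v u : V) r t :
  reach adj v u -> ~ ball adj v r u -> (t <= S r)%nat -> exists z, sphere adj v t z.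
Proof.
  intros [n0 W0] Hr Ht.
  destruct (nat_least (fun n => walk adj v u n) n0 W0) as [n [W Hmin]].
  assert (r < n)%nat
    by (destruct (le_lt_dec n r); [exfalso; apply Hr; exists n; auto | assumption]).
  replace n with (t + (n - t))%nat in W by lia.
  apply walk_split in W as [z [W1 W2]]; exists z; split.
  - exists t; auto.
  - intros s Hs [m [Hm W3]].
    apply (Hmin (m + (n - t))%nat); [lia | eapply walk_app; eauto].
Qed.

Lemma ball_many adj (v u : V) r t :
  reach adj v u -> ~ ball adj v r u -> (t <= S r)%nat ->
  exists l, NoDup l /\ Forall (ball adj v t) l /\ length l = S t.
Proof.
  intros W Hr; induction t as [| t IH]; intros Ht.
  - exists [v]; repeat constructor; auto using ball_center.
  - destruct IH as [l (Hnd & Hl & Hlen)]; [lia |].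
    destruct (sphere_inhabited adj v u r (S t) W Hr Ht) as [z [Hz Hz']].
    exists (z :: l); repeat split; simpl; auto.
    + constructor; [| exact Hnd]; intros Hin; rewrite Forall_forall in Hl.
      apply (Hz' t); [lia | auto].
    + constructor; [exact Hz |]; eapply Forall_impl; [| exact Hl].
      intros a; apply ball_mono; lia.
Qed.

Lemma growth_ball adj r (k : R) (v : V) :
  (forall a b, adj a b -> adj b a) -> growth_le adj r k -> card_le (ball adj v r) k.
Proof.
  intros Hs Hg; apply (Hg _ (inside adj (ball adj v r))).
  - split; [| split]; intros x y (Hxy & Hx & Hy); unfold inside; auto.
  (* The induction remembers the length [m] already walked from [v], which keeps every vertex of the
     walk inside the ball. *)
  - assert (H : forall x u n, walk adj x u n -> forall m, walk adj v x m ->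
              (m + n <= r)%nat -> walk (inside adj (ball adj v r)) x u n).
    { induction 1 as [x | x y z n Hxy W IH]; intros m Hm Hmn; [constructor |].
      assert (Hy : walk adj v y (m + 1)) by (eapply walk_app; [exact Hm | apply walk_step, Hxy]).
      apply walkS with y; [| apply IH with (m + 1)%nat; [exact Hy | lia]].
      repeat split; [exact Hxy | exists m | exists (m + 1)%nat]; split; auto; lia. }
    exists v; split; [apply ball_center |]; intros u [n [Hn W]]; exists n; split; [exact Hn |].
    apply H with 0%nat; [exact W | constructor | lia].
Qed.
End Walks.

(** * Balanced separators from the linear bound on balls *)

Section Separator.
Context {V : Type} (adj : V -> V -> Prop) (c : R).
Context (adj_sym : forall x y, adj x y -> adj y x).
Context (ball_card : forall v r, (1 <= r)%nat -> card_le (ball adj v r) (c * INR r)).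

Lemma ball_finite v r : exists l, NoDup l /\ forall x, In x l <-> ball adj v r x.
Proof.
  (* The ball bound starts at radius 1, so the radius is enlarged to cover [r = 0]. *)
  apply card_le_enum with (c * INR (S r)).
  apply card_le_mono with (ball adj v (S r)) (c * INR (S r)); [| lra | apply ball_card; lia].
  intros x; apply ball_mono; lia.
Qed.

(** Spheres of different radii about [v] are disjoint, so [k] spheres with more than [b] vertices
    each add up. *)
Lemma small_sphere_or_many v d (b : R) k :
  (exists t L, (d <= t < d + k)%nat /\ INR (length L) <= b /\
     forall z, sphere adj v t z -> In z L) \/
  (exists l, NoDup l /\ b * INR k <= INR (length l) /\
     forall z, In z l -> exists t, (t < d + k)%nat /\ sphere adj v t z).
Proof.
  induction k as [| k IH].
  - right; exists []; repeat split; [constructor | simpl; lra | intros z []].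
  - destruct IH as [(t & L & Ht & HL) | (l & Hnd & Hl & Hs)].
    { left; exists t, L; split; [lia | exact HL]. }
    destruct (ball_finite v (d + k)) as [B [HB HBi]].
    destruct (card_le_enum (sphere adj v (d + k)) (INR (length B))) as [L [HL HLi]].
    { eapply card_le_mono; [| apply Rle_refl | apply card_le_In].
      intros x [Hx _]; apply HBi, Hx. }
    destruct (Rle_dec (INR (length L)) b) as [Hle | Hlt].
    + left; exists (d + k)%nat, L; repeat split; [lia | lia | exact Hle |].
      intros z; apply HLi.
    + right; exists (L ++ l); repeat split.
      * apply NoDup_app; auto; intros x Hx Hx'.
        apply HLi in Hx as [_ Hx]; apply Hs in Hx' as (t & Ht & Hx' & _).
        apply (Hx t); [lia | exact Hx'].
      * rewrite length_app, plus_INR, S_INR; lra.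
      * intros z [Hz | Hz]%in_app_or.
        -- exists (d + k)%nat; split; [lia | apply HLi, Hz].
        -- apply Hs in Hz as (t & Ht & Hz); exists t; split; [lia | exact Hz].
Qed.

(** Otherwise the r + 1 - d spheres would put at least 2c(r + 1 - d) > cr vertices into the ball of
    radius [r]. *)
Lemma small_sphere v d r :
  0 < c -> (1 <= d <= r)%nat -> (r < 2 * (S r - d))%nat ->
  exists t L, (d <= t <= r)%nat /\ INR (length L) <= 2 * c /\
     forall z, sphere adj v t z -> In z L.
Proof.
  intros Hc Hd Hr.
  destruct (small_sphere_or_many v d (2 * c) (S r - d))
    as [(t & L & Ht & HL) | (l & Hnd & Hl & Hs)].
  { exists t, L; split; [lia | exact HL]. }
  exfalso.
  assert (H : INR (length l) <= c * INR r).
  { apply (ball_card v); [lia | exact Hnd |].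
    apply Forall_forall; intros z Hz; apply Hs in Hz as (t & Ht & Hz & _).
    eapply ball_mono; [| exact Hz]; lia. }
  apply lt_INR in Hr; rewrite mult_INR in Hr; change (INR 2) with 2 in Hr; nra.
Qed.

Lemma disjoint_balls (U : list V) (e m : nat) :
  ForallOrdPairs (fun u u' => forall z, ball adj u e z -> ~ ball adj u' e z) U ->
  Forall (fun u => exists l, NoDup l /\ Forall (ball adj u e) l /\ length l = m) U ->
  exists l, NoDup l /\ length l = (length U * m)%nat /\
    Forall (fun z => exists u, In u U /\ ball adj u e z) l.
Proof.
  induction U as [| u U IH]; intros HP HF.
  - exists []; repeat constructor.
  - inversion HP as [| ? ? Hu HU]; inversion HF as [| ? ? Hex HF']; subst.
    destruct Hex as [l (Hnd & Hl & Hlen)].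
    destruct (IH HU HF') as [l' (Hnd' & Hlen' & Hl')].
    rewrite Forall_forall in Hu, Hl, Hl'.
    exists (l ++ l'); repeat split.
    + apply NoDup_app; auto; intros z Hz Hz'.
      apply Hl' in Hz' as [u' [Hu' Hz']]; exact (Hu u' Hu' z (Hl z Hz) Hz').
    + rewrite length_app, Hlen'; simpl; lia.
    + apply Forall_forall; intros z [Hz | Hz]%in_app_or.
      * exists u; split; [left; reflexivity | auto].
      * destruct (Hl' z Hz) as [u' [? ?]]; exists u'; split; [right |]; auto.
Qed.

(** In a packing of greatest size, an uncovered vertex [y] could still be added. *)
Lemma maximal_packing v r d :
  exists U, Forall (ball adj v r) U /\
    ForallOrdPairs (fun u u' => ~ ball adj u d u') U /\
    forall y, ball adj v r y -> exists u, In u U /\ ball adj u d y.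
Proof.
  destruct (ball_finite v r) as [B [_ HB]].
  pose (pack := fun U => Forall (ball adj v r) U /\
    ForallOrdPairs (fun u u' => ~ ball adj u d u') U).
  destruct (nat_greatest (fun n => exists U, pack U /\ length U = n) 0 (INR (length B)))
    as [m [[U [[HU HP] Hm]] Hmax]].
  - exists []; repeat constructor.
  - intros m [U [[HU HP] <-]].
    apply card_le_In.
    + clear HU; induction HP as [| u U Hu HP IH]; constructor; auto; intros Hin.
      rewrite Forall_forall in Hu; exact (Hu u Hin (ball_center adj u d)).
    + eapply Forall_impl; [| exact HU]; intros a; apply HB.
  - exists U; repeat split; auto; intros y Hy; apply NNPP; intros Hn.
    assert (S m <= m)%nat; [| lia].
    apply Hmax; exists (y :: U); repeat split; simpl; [| | congruence].
    + constructor; auto.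
    + constructor; auto; apply Forall_forall; intros u Hu Hb.
      apply Hn; exists u; split; [exact Hu | apply ball_sym; auto].
Qed.

Lemma union_of_spheres (U : list V) d r (b : R) :
  (forall u, exists t L, (d <= t <= r)%nat /\ INR (length L) <= b /\
     forall z, sphere adj u t z -> In z L) ->
  exists X, INR (length X) <= b * INR (length U) /\
    forall u, In u U -> exists t, (d <= t <= r)%nat /\ forall z, sphere adj u t z -> In z X.
Proof.
  intros H; induction U as [| u U [X [HX HU]]].
  - exists []; split; [simpl; lra | intros u []].
  - destruct (H u) as (t & L & Ht & HL & Hs); exists (L ++ X); split.
    + rewrite length_app, plus_INR; simpl length; rewrite S_INR; lra.
    + intros w [<- | Hw].
      * exists t; split; [exact Ht |]; intros z Hz; apply in_or_app; auto.
      * destruct (HU w Hw) as [t' [Ht' Hs']]; exists t'; split; [exact Ht' |].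
        intros z Hz; apply in_or_app; auto.
Qed.

Lemma reach_list_ball x (l : list V) :
  Forall (reach adj x) l -> exists r, Forall (ball adj x r) l.
Proof.
  induction 1 as [| y l [n W] _ [r Hr]]; [exists 0%nat; constructor |].
  exists (n + r)%nat; constructor; [exists n; split; [lia | exact W] |].
  eapply Forall_impl; [| exact Hr]; intros a; apply ball_mono; lia.
Qed.

Lemma comp_reach (P : V -> Prop) x y : comp adj P x y -> reach adj x y.
Proof. intros [_ W]; eapply reach_mono; [| exact W]; intros a b [H _]; exact H. Qed.

(* A majority component avoiding X would meet the minimal majority ball, hence some [ball u d] with
   [u] in the packing; by minimality of the radius it also leaves [ball u (t - 1)], so it
   crosses the sphere of radius [t] about [u], which lies in X. *)
Lemma balanced_separator (A : list V) :
  1 <= c ->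
  exists X, INR (length X) <= 10 * c ^ 2 /\
    forall x, ~ majority A (comp adj (fun y => ~ In y X) x).
Proof.
  intros Hc.
  destruct (classic (exists r v, majority A (ball adj v r))) as [[r0 Hr0] | Hno].
  (* If no ball holds a majority, nothing is deleted: finitely many vertices of one component always
     lie in a common ball. *)
  2:{ exists []; split; [simpl; nra |]; intros x [l (Hnd & Hi & Hl & Hlen)].
      destruct (reach_list_ball x l) as [r Hr].
      { eapply Forall_impl; [| exact Hl]; intros a; apply comp_reach. }
      apply Hno; exists r, x, l; auto. }
  destruct (nat_least (fun r => exists v, majority A (ball adj v r)) _ Hr0) as [r [[v Hv] Hmin]]; clear r0 Hr0.
  destruct r as [| r].
  { exists [v]; split; [simpl; nra |]; intros x Hx.
    destruct (majority_meet _ _ _ Hx Hv) as [y [Hy Hyv]].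
    apply ball_0 in Hyv; subst; apply comp_sub in Hy; simpl in Hy; tauto. }
  (* The critical radius is r + 1: d is about half of it, and the balls of radius e about
     points at distance more than d are disjoint. *)
  set (d := ((r + 2) / 2)%nat).
  assert (Hd : (2 * d <= r + 2 < 2 * d + 2)%nat)
    by (pose proof (Nat.div_mod_eq (r + 2) 2); pose proof (Nat.mod_upper_bound (r + 2) 2);
        unfold d; lia).
  set (e := (d / 2)%nat).
  assert (He : (2 * e <= d < 2 * e + 2)%nat)
    by (pose proof (Nat.div_mod_eq d 2); pose proof (Nat.mod_upper_bound d 2);
        unfold e; lia).
  clearbody d e.
  destruct (maximal_packing v (S r) d) as (U & HUv & HU & Hcov).
  assert (Hsmall : forall u, ~ majority A (ball adj u r))
    by (intros u Hu; apply (Hmin r); [lia | eauto]).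
  (* The disjoint balls of radius [e] about [U] have at least e + 1 vertices each and lie in the
     ball of radius r + 1 + e about [v]. The factor 5 comes from r + 1 + e <= 5(e + 1). *)
  assert (HUcard : INR (length U) <= 5 * c).
  { destruct (disjoint_balls U e (S e)) as (l & Hnd & Hlen & Hl).
    - clear HUv Hcov; induction HU as [| u U Hu HU IH]; constructor; auto.
      eapply Forall_impl; [| exact Hu]; intros u' Hu' z Hz Hz'; apply Hu'.
      apply ball_mono with (e + e)%nat; [lia |].
      eapply ball_trans; [exact Hz | apply ball_sym; auto].
    - eapply Forall_impl; [| exact HUv]; intros u Hu.
      (* A vertex [y] beyond distance [r] from [u] exists by minimality of the radius; a walk to it
         supplies the e + 1 vertices. *)
      destruct (majority_witness _ _ _ Hv (Hsmall u)) as [y [Hy Hyu]].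
      apply (ball_many adj u y r e); [| exact Hyu | lia].
      apply reach_trans with v.
      + apply reach_sym; [exact adj_sym | destruct Hu as [n [_ W]]; exists n; exact W].
      + destruct Hy as [n [_ W]]; exists n; exact W.
    - assert (H : INR (length l) <= c * INR (S r + e)).
      { apply (ball_card v); [lia | exact Hnd |].
        eapply Forall_impl; [| exact Hl]; intros z [u [Hu Hz]].
        rewrite Forall_forall in HUv; eapply ball_trans; eauto. }
      rewrite Hlen, mult_INR in H.
      assert (H5 : INR (S r + e) <= 5 * INR (S e)).
      { replace 5 with (INR 5) by (simpl; lra); rewrite <- mult_INR; apply le_INR; lia. }
      pose proof (lt_0_INR (S e) ltac:(lia)); nra. }
  (* At most 5c spheres of at most 2c vertices each give 10c^2. *)
  destruct (union_of_spheres U d (S r) (2 * c)) as [X [HX Hsep]].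
  { intros u; apply small_sphere; [lra | lia | lia]. }
  exists X; split; [nra |]; intros x Hx.
  destruct (majority_meet _ _ _ Hx Hv) as [y [Hy Hyv]].
  destruct (Hcov y Hyv) as [u [Hu Hyu]].
  destruct (Hsep u Hu) as [t [Ht HtX]].
  assert (Hyt : ball adj u (t - 1) y).
  { apply NNPP; intros Hn; apply (comp_sub _ _ _ _ Hy), HtX; split.
    - eapply ball_mono; [| exact Hyu]; lia.
    - intros s Hs Hb; apply Hn; eapply ball_mono; [| exact Hb]; lia. }
  destruct (majority_witness A _ (ball adj u (t - 1)) Hx) as [z [Hz Hzt]].
  { intros Hm; apply (Hsmall u); eapply majority_mono; [| exact Hm].
    intros w; apply ball_mono; lia. }
  rewrite (comp_eq _ _ _ _ adj_sym Hy) in Hz; destruct Hz as [_ Hz].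
  destruct (reach_exit _ _ _ _ Hz Hyt Hzt) as (a & b & (Hab & _ & HbX) & Ha & Hb).
  apply HbX, HtX; split.
  - replace t with (t - 1 + 1)%nat by lia; eapply ball_trans; [exact Ha |].
    exists 1%nat; split; [lia | apply walk_step, Hab].
  - intros s Hs Hbs; apply Hb; eapply ball_mono; [| exact Hbs]; lia.
Qed.
End Separator.

(** * The tree of lists, rooted at the empty list *)

Section ListTree.
Context {A : Type}.

Definition list_adj (x y : list A) : Prop := (exists a, x = a :: y) \/ (exists a, y = a :: x).

Lemma list_adj_sym x y : list_adj x y -> list_adj y x.
Proof. unfold list_adj; tauto. Qed.

(** Membership of [x] in the branch rooted at [y]. *)
Definition descends (y x : list A) : Prop := exists p, x = p ++ y.

Lemma descends_length x y : descends y x -> (length y <= length x)%nat.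
Proof. intros [p ->]; rewrite length_app; lia. Qed.

Lemma descends_cons a x y : descends y (a :: x) <-> y = a :: x \/ descends y x.
Proof.
  split.
  - intros [[| b p] H]; simpl in H; [left; congruence |].
    injection H as _ ->; right; exists p; reflexivity.
  - intros [-> | [p ->]]; [exists [] | exists (a :: p)]; reflexivity.
Qed.

Lemma last_cons_default (B : Type) (x y : B) l : last (y :: l) x = last l y.
Proof.
  revert x y; induction l as [| z l IH]; intros x y; [reflexivity |].
  change (last (z :: l) x = last (z :: l) y); rewrite !IH; reflexivity.
Qed.

Lemma last_In_cons (B : Type) (x : B) l : In (last l x) (x :: l).
Proof.
  revert x; induction l as [| y l IH]; intros x; [left; reflexivity |].
  rewrite last_cons_default; right; apply IH.
Qed.

(* A branch can only be entered or left through its root. *)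
Lemma chain_descends (x y : list A) l :
  chain list_adj x l -> ~ In y (x :: l) -> (descends y (last l x) <-> descends y x).
Proof.
  revert x; induction l as [| z l IH]; intros x Hc Hy; [reflexivity |].
  destruct Hc as [Hxz Hc].
  rewrite last_cons_default, IH; [| exact Hc | intros H; apply Hy; right; exact H].
  destruct Hxz as [[a ->] | [a ->]]; rewrite descends_cons; simpl in Hy; intuition congruence.
Qed.

(** Let the cycle go from [x] to [y]. If [y] is the parent of [x], the cycle returns through a child
    of [x], so it enters the branch at [x] while avoiding [x]. If [y] is a child, the cycle goes on
    into the branch at [y] and must leave it while avoiding [y]. *)
Lemma list_tree_acyclic : ~ has_cycle list_adj.
Proof.
  intros (x & l & Hnd & Hlen & Hc & Hlast).
  destruct l as [| y l]; [simpl in Hlen; lia |].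
  destruct l as [| z l]; [simpl in Hlen; lia |].
  rewrite !last_cons_default in Hlast.
  destruct Hc as [Hxy [Hyz Hc]].
  inversion Hnd as [| ? ? Hx Hnd']; inversion Hnd' as [| ? ? Hy _]; subst.
  pose proof (last_In_cons _ z l) as Hin.
  set (e := last l z) in *.
  assert (Hey : e <> y) by congruence.
  destruct Hxy as [[a ->] | [a ->]].
  - destruct Hlast as [[b He] | [b He]]; [| congruence].
    assert (Hd : descends (a :: y) y).
    { apply (chain_descends y (a :: y) (z :: l)); [split; assumption | exact Hx |].
      rewrite last_cons_default; fold e; rewrite He; exists [b]; reflexivity. }
    apply descends_length in Hd; simpl in Hd; lia.
  - destruct Hyz as [[b Hb] | [b ->]].
    { injection Hb as _ ->; apply Hx; right; left; reflexivity. }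
    assert (Hde : descends (a :: x) e)
      by (apply (chain_descends _ (a :: x) l Hc Hy); exists [b]; reflexivity).
    destruct Hlast as [[d He] | [d He]].
    + rewrite He in Hde; apply descends_cons in Hde as [Hde | Hde]; [congruence |].
      apply descends_length in Hde; simpl in Hde; lia.
    + apply descends_length in Hde; rewrite He in Hde; simpl in Hde; lia.
Qed.

Lemma list_adj_is_tree : is_tree list_adj.
Proof.
  split; [exists []; exact I |].
  split; [exact list_adj_sym |].
  split; [intros x [[a H] | [a H]]; apply (f_equal (@length A)) in H; simpl in H; lia |].
  split; [| exact list_tree_acyclic].
  assert (H : forall x, reach list_adj x []).
  { induction x as [| a x IH]; [apply reach_refl |].
    eapply reach_trans; [apply reach_step; left; exists a; reflexivity | exact IH]. }
  intros x y; apply reach_trans with []; [apply H | apply reach_sym; [exact list_adj_sym | apply H]].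
Qed.
End ListTree.

(** * Recursive construction of the tree-decomposition *)

Section Decomposition.
Context {V : Type} (adj : V -> V -> Prop) (c : R) (hc : 1 <= c).
Context (adj_sym : forall x y, adj x y -> adj y x).
Context (ball_card : forall v r, (1 <= r)%nat -> card_le (ball adj v r) (c * INR r)).
Context (h : V -> nat).
Context (h_finite : forall v, exists l, forall u, reach adj v u -> (h u <= h v)%nat -> In u l).

(* The bound 20c^2+2 reproduces itself: a component of C - Z sees at most 10c^2 vertices of
   the separator, w, and half of N(C), i.e. at most 10c^2+1 further vertices. *)
Definition good_bag (C Z : V -> Prop) : Prop :=
  (forall u, nbhd adj C u -> Z u) /\
  (forall u, Z u -> C u \/ nbhd adj C u) /\
  card_le Z (30 * c ^ 2 + 3) /\
  (exists w, C w /\ Z w /\ forall u, C u -> (h w <= h u)%nat) /\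
  forall x, card_le (nbhd adj (comp adj (fun y => C y /\ ~ Z y) x)) (20 * c ^ 2 + 2).

Lemma not_majority_card (A : list V) (Q : V -> Prop) :
  ~ majority A Q -> card_le (fun x => In x A /\ Q x) (INR (length A) / 2).
Proof.
  intros H l Hnd Hl; rewrite Forall_forall in Hl.
  destruct (le_lt_dec (2 * length l) (length A)) as [Hle | Hlt].
  - apply le_INR in Hle; rewrite mult_INR in Hle; change (INR 2) with 2 in Hle; lra.
  - exfalso; apply H; exists l; repeat split; auto.
    + intros x Hx; apply Hl, Hx.
    + apply Forall_forall; intros x Hx; apply Hl, Hx.
Qed.

(** A component D of C - Z avoids X, so it lies in one component K of G - X. A neighbour of D
    outside X and other than w cannot lie in C, as it would belong to D; so it lies in both N(C) and
    K, which share at most half of N(C). *)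
Lemma good_bag_exists (C : V -> Prop) :
  (exists x, C x) -> card_le (nbhd adj C) (20 * c ^ 2 + 2) -> exists Z, good_bag C Z.
Proof.
  intros [x0 Hx0] HC.
  destruct (nat_least (fun n => exists w, C w /\ h w = n) (h x0)) as [n [[w [Hw Hwn]] Hmin]];
    [eauto |].
  destruct (card_le_enum _ _ HC) as [A [HAnd HA]].
  destruct (balanced_separator adj c adj_sym ball_card A hc) as [X [HX Hsep]].
  assert (HAlen : INR (length A) <= 20 * c ^ 2 + 2)
    by (apply HC; [exact HAnd | apply Forall_forall; intros x; apply HA]).
  assert (Hw1 : card_le (fun u => In u [w]) 1)
    by (eapply card_le_mono; [| | apply (card_le_In [w])]; [auto | simpl; lra]).
  set (Z := fun u => nbhd adj C u \/ (C u /\ (In u X \/ u = w))).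
  exists Z; split; [| split; [| split; [| split]]].
  - left; assumption.
  - unfold Z; tauto.
  - eapply card_le_mono; [| | apply card_le_union;
      [exact HC | apply card_le_union; [apply (card_le_In X) | exact Hw1]]]; [| lra].
    unfold Z; simpl; intuition.
  - exists w; unfold Z; repeat split; auto; intros u Hu.
    destruct (le_lt_dec (h w) (h u)) as [| Hlt]; [assumption | exfalso].
    apply (Hmin (h u)); [lia | eauto].
  - intros x.
    eapply card_le_mono; [| | apply card_le_union; [apply (not_majority_card A), (Hsep x) |
      apply card_le_union; [apply (card_le_In X) | exact Hw1]]]; [| lra].
    simpl; intros u [Hu [y [Hy Hyu]]].
    pose proof (comp_sub _ _ _ _ Hy) as [HyC HyZ].
    destruct (classic (In u X)) as [| HuX]; [tauto |].
    destruct (classic (C u)) as [HuC | HuC].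
    + destruct (classic (Z u)) as [[[HnC _] | [_ [HuX' | ->]]] | HuZ]; [tauto | tauto | auto |].
      exfalso; apply Hu; apply comp_step with y; auto.
    + left; split; [apply HA; split; eauto |].
      apply comp_step with y; auto; eapply comp_mono; [| exact Hy].
      intros z [HzC HzZ] HzX; apply HzZ; right; auto.
Qed.

(** The set [C] under [inhabits] only witnesses that vertex sets exist; the choice is a good bag
    whenever there is one. *)
Definition bag_of (C : V -> Prop) : V -> Prop := epsilon (inhabits C) (good_bag C).

(* A node lists the nested components from its own up to the root, so that its parent
   is its tail; lists that do not arise this way get an empty bag. *)
Definition region (x : list (V -> Prop)) : V -> Prop :=
  match x with [] => fun _ => True | C :: _ => C end.

Definition pre_bag (x : list (V -> Prop)) : V -> Prop :=
  match x with [] => fun _ => False | C :: _ => bag_of C end.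

Definition rest (x : list (V -> Prop)) (z : V) : Prop := region x z /\ ~ pre_bag x z.

Fixpoint valid (x : list (V -> Prop)) : Prop :=
  match x with
  | [] => True
  | C :: y => valid y /\ exists u, C u /\ C = comp adj (rest y) u
  end.

Definition bag (x : list (V -> Prop)) (v : V) : Prop := valid x /\ pre_bag x v.

(** Below the root, [C] is a component of G and has no neighbours; deeper down, the last clause of
    the parent's good bag bounds the neighbourhood of [C]. *)
Lemma valid_good_bag C y : valid (C :: y) -> good_bag C (bag_of C).
Proof.
  revert C; induction y as [| D y IH]; intros C [Hy (u & Hu & HC)];
    unfold bag_of; apply epsilon_spec, good_bag_exists; eauto.
  - intros [| w l] _ Hl; [simpl; nra | exfalso].
    apply Forall_inv in Hl as [Hw (z & Hz & Hzw)]; apply Hw; subst C.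
    apply comp_step with z; auto; split; simpl; auto.
  - subst C; apply (IH D Hy).
Qed.

Lemma nbhd_region_bag x u : valid x -> nbhd adj (region x) u -> pre_bag x u.
Proof.
  destruct x as [| C y]; simpl; [intros _ [H _]; tauto |].
  intros H; apply (valid_good_bag C y H).
Qed.

Lemma pre_bag_region x u : valid x -> pre_bag x u -> region x u \/ nbhd adj (region x) u.
Proof.
  destruct x as [| C y]; simpl; [tauto |]; intros H; apply (valid_good_bag C y H).
Qed.

Lemma region_child C y u : valid (C :: y) -> C u -> rest y u.
Proof. intros [_ (w & _ & ->)]; apply comp_sub. Qed.

(** Inside the parent's region, a neighbour of [C] missed by the parent's bag would belong to [C];
    outside, it is a neighbour of that region, and the bag contains all of these. *)
Lemma nbhd_child C y u : valid (C :: y) -> nbhd adj C u -> pre_bag y u.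
Proof.
  intros H [Hu (z & Hz & Hzu)]; pose proof (region_child C y z H Hz) as [Hzr _].
  destruct H as [Hy (w & _ & ->)].
  destruct (classic (region y u)) as [Hr | Hr].
  - apply NNPP; intros Hn; apply Hu; apply comp_step with z; auto; split; auto.
  - apply nbhd_region_bag; [exact Hy |]; split; eauto.
Qed.

Lemma bag_card x : card_le (bag x) (30 * c ^ 2 + 3).
Proof.
  destruct (classic (valid x)) as [Hx | Hx].
  - destruct x as [| C y].
    + intros [| w l] _ Hl; [simpl; nra |]; apply Forall_inv in Hl as [_ []].
    + eapply card_le_mono; [| apply Rle_refl | apply (valid_good_bag C y Hx)].
      intros u [_ H]; exact H.
  - intros [| w l] _ Hl; [simpl; nra |]; apply Forall_inv in Hl as [Hl _]; tauto.
Qed.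

(** The only candidate at depth [n] for a valid node whose region contains [v]. Once a bag has taken
    [v], the next component is empty. *)
Fixpoint node (v : V) (n : nat) : list (V -> Prop) :=
  match n with
  | O => []
  | S m => comp adj (rest (node v m)) v :: node v m
  end.

Lemma valid_node x v : valid x -> region x v -> x = node v (length x).
Proof.
  induction x as [| C y IH]; [reflexivity |]; intros Hx Hv; simpl.
  pose proof (region_child C y v Hx Hv) as [Hr _].
  destruct Hx as [Hy (u & _ & HC)]; rewrite <- (IH Hy Hr); f_equal.
  subst C; apply comp_eq; auto.
Qed.

Lemma node_above v m n : (m < n)%nat -> region (node v n) v -> ~ pre_bag (node v m) v.
Proof.
  induction n as [| n IH]; [lia |]; intros Hm Hr.
  apply comp_sub in Hr as [Hr Hb].
  destruct (Nat.eq_dec m n) as [-> | Hne]; [exact Hb | apply IH; [lia | exact Hr]].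
Qed.

(** The node where [v], after surviving all bags above, is taken out of its region. *)
Definition home (v : V) (n : nat) : Prop :=
  valid (node v n) /\ region (node v n) v /\ pre_bag (node v n) v.

Lemma home_bag v n : home v n -> bag (node v n) v.
Proof. intros (? & _ & ?); split; auto. Qed.

Lemma home_of_bag v n x :
  home v n -> valid x -> region x v -> pre_bag x v -> x = node v n.
Proof.
  intros (Hv & Hr & Hb) Hx Hxr Hxb.
  pose proof (valid_node x v Hx Hxr) as E.
  destruct (lt_eq_lt_dec (length x) n) as [[Hlt | <-] | Hlt]; [| exact E |].
  - exfalso; apply (node_above v _ _ Hlt Hr); rewrite <- E; exact Hxb.
  - exfalso; rewrite E in Hxr; exact (node_above v _ _ Hlt Hxr Hb).
Qed.

(** Induction on the length of a list containing all vertices of the current region with [h] at most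
    [h v]. If the bag misses [v], it still takes a vertex [w] of least [h], which drops out of the
    list for the child containing [v]. *)
Lemma home_exists v : exists n, home v n.
Proof.
  assert (H : forall k l, length l = k -> forall C y, valid (C :: y) -> C v ->
    (forall u, C u -> (h u <= h v)%nat -> In u l) -> exists n, home v n).
  { induction k as [| k IH]; intros l Hk C y Hx Hv Hl.
    - destruct l; [destruct (Hl v Hv (le_n _)) | discriminate].
    - pose proof (valid_node (C :: y) v Hx Hv) as E.
      destruct (classic (bag_of C v)) as [Hb | Hb].
      { exists (length (C :: y)); unfold home; rewrite <- E; auto. }
      destruct (valid_good_bag C y Hx) as (_ & _ & _ & (w & Hw & Hwb & Hmin) & _).
      destruct (in_split w l) as (l1 & l2 & ->); [apply Hl; auto |].
      apply (IH (l1 ++ l2)) with (C := comp adj (rest (C :: y)) v) (y := C :: y).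
      + rewrite length_app in *; simpl in Hk; lia.
      + split; [exact Hx | exists v; split; [apply comp_refl; split; auto | reflexivity]].
      + apply comp_refl; split; auto.
      + intros u [HuC Hub]%comp_sub Hhu.
        specialize (Hl u HuC Hhu); apply in_elt_inv in Hl as [<- | Hl]; [contradiction | exact Hl]. }
  destruct (h_finite v) as [l Hl].
  assert (Hv : comp adj (rest []) v v) by (apply comp_refl; split; simpl; auto).
  apply (H (length l) l eq_refl (comp adj (rest []) v) []); auto.
  - split; [exact I | eauto].
  - intros u Hu; apply Hl; eapply comp_reach; eauto.
Qed.

(** If [v] lies in the region of a node whose bag contains it, that node is its home; otherwise [v]
    neighbours the region, so the parent's bag contains it too and one climbs. *)
Lemma reach_home v n x :
  home v n -> bag x v ->
  reach (fun a b => list_adj a b /\ bag a v /\ bag b v) x (node v n).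
Proof.
  intros Hn; induction x as [| C y IH]; intros [Hx Hb]; [destruct Hb |].
  destruct (pre_bag_region _ _ Hx Hb) as [Hr | Hr].
  - rewrite (home_of_bag v n (C :: y) Hn Hx Hr Hb); apply reach_refl.
  - assert (Hy : bag y v) by (split; [apply Hx | apply (nbhd_child C y v Hx Hr)]).
    eapply reach_trans; [| apply (IH Hy)]; apply reach_step; repeat split; try apply Hy; auto.
    + left; eauto.
    + apply Hx.
Qed.

(** The deeper home belongs to [v]. If [u] is in its region, no bag above has taken [u], so both
    homes coincide; if not, [u] neighbours that region. *)
Lemma edge_in_home u v n m :
  adj v u -> home u n -> home v m -> (n <= m)%nat -> bag (node v m) u.
Proof.
  intros Hvu Hu Hv Hnm; pose proof Hv as (Hval & Hr & _); split; [exact Hval |].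
  destruct (classic (region (node v m) u)) as [Hur | Hur].
  - assert (Hlen : length (node v m) = m) by (clear; induction m; simpl; auto).
    pose proof (valid_node _ u Hval Hur) as E; rewrite Hlen in E; rewrite E in Hur |- *.
    destruct (Nat.eq_dec n m) as [<- | Hne]; [apply Hu |].
    exfalso; apply (node_above u n m); [lia | exact Hur | apply Hu].
  - apply nbhd_region_bag; [exact Hval |]; split; eauto.
Qed.

Lemma bag_tree_decomposition : tree_decomposition adj list_adj bag.
Proof.
  split; [exact list_adj_is_tree | split].
  - intros u v Huv.
    destruct (home_exists u) as [n Hn]; destruct (home_exists v) as [m Hm].
    destruct (le_ge_dec n m) as [H | H].
    + exists (node v m); split; [apply (edge_in_home u v n m) | apply home_bag]; auto.
    + exists (node u n); split; [apply home_bag | apply (edge_in_home v u m n)]; auto.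
  - intros v; destruct (home_exists v) as [n Hn]; split.
    + exists (node v n); apply home_bag, Hn.
    + intros x y Hx Hy; apply reach_trans with (node v n); [apply reach_home; auto |].
      apply reach_sym; [| apply reach_home; auto].
      intros a b (Hab & Ha & Hb); split; [apply list_adj_sym, Hab | split; assumption].
Qed.
End Decomposition.

(** * A depth function for infinite graphs, and the final bound *)

Lemma finite_below_depth (V : Type) (adj : V -> V -> Prop) :
  (forall x y, adj x y -> adj y x) ->
  (forall v r, exists l, NoDup l /\ forall x, In x l <-> ball adj v r x) ->
  exists h : V -> nat,
    forall v, exists l, forall u, reach adj v u -> (h u <= h v)%nat -> In u l.
Proof.
  intros Hs Hfin; destruct (classic (inhabited V)) as [i | Hi].
  2:{ exists (fun _ => 0%nat); intros v; destruct (Hi (inhabits v)). }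
  (* Vertices of one component have equal reachability predicates, so the choice yields one base
     point per component. *)
  pose (rep := fun v => epsilon i (reach adj v)).
  assert (Hrep : forall v, reach adj v (rep v))
    by (intros v; apply epsilon_spec; exists v; apply reach_refl).
  (* The length of some walk from the base point, not necessarily a shortest one; a bound on it
     still confines a vertex to a finite ball. *)
  pose (h := fun v => epsilon (inhabits 0%nat) (walk adj (rep v) v)).
  assert (Hh : forall v, walk adj (rep v) v (h v))
    by (intros v; apply epsilon_spec; apply reach_sym; auto).
  exists h; intros v; destruct (Hfin (rep v) (h v)) as [l [_ Hl]]; exists l.
  intros u Hu Hhu; apply Hl; exists (h u); split; [exact Hhu |].
  replace (rep v) with (rep u); [apply Hh |].
  unfold rep; f_equal; apply functional_extensionality; intros z.
  apply propositional_extensionality; split; intros Hz.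
  - apply reach_trans with u; assumption.
  - apply reach_trans with v; [apply reach_sym |]; assumption.
Qed.

Theorem theorem1 (c : R) (V : Type) (adj : V -> V -> Prop)
  (hc : 1 <= c)
  (hsym : forall x y, adj x y -> adj y x)
  (hgrowth : forall r : nat, (1 <= r)%nat -> growth_le adj r (c * INR r)) :
  treewidth_le adj (49 * c ^ 2 + 30 * c).
Proof.
  assert (Hball : forall v r, (1 <= r)%nat -> card_le (ball adj v r) (c * INR r))
    by (intros v r Hr; apply growth_ball; auto).
  destruct (finite_below_depth V adj hsym (ball_finite adj c Hball)) as [h Hh].
  exists (list (V -> Prop)), list_adj, (bag adj c h); split.
  - apply bag_tree_decomposition; auto.
  (* For c >= 1, 30c^2 + 3 is at most (49c^2 + 30c) + 1. *)
  - intros x; apply card_le_mono with (bag adj c h x) (30 * c ^ 2 + 3); [auto | nra |].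
    apply bag_card; auto.
Qed.
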